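(* Let $G\ge 2$ and let $R_1,\dots,R_G\in\mathbb{R}$. Let $\mu=\frac1G\sum_{j=1}^G R_j$ and, for each $i$, let $b_i=\frac{1}{G-1}\sum_{j\ne i}R_j$. Then $$R_i-\mu=\frac{G-1}{G}\,(R_i-b_i)\qquad\text{for every } i\in\{1,\dots,G\}.$$
   Context: The numbers $R_i$ are the scalar rewards of a group of $G$ sampled responses; $b_i$ is called the leave-one-out (RLOO) baseline. *)

(* Defs.v *)
From mathcomp Require Import all_boot all_order all_algebra.
From mathcomp Require Import reals.

Set Implicit Arguments.
Unset Strict Implicit.
Unset Printing Implicit Defensive.

Import GRing.Theory Num.Theory.

Local Open Scope ring_scope.

Definition group_mean (R : realType) (G : nat) (r : 'I_G -> R) : R :=
  G%:R^-1 * \sum_(j < G) r j.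

(* G - 1 is computed in R, so there is no truncated subtraction. *)
Definition rloo_baseline (R : realType) (G : nat) (r : 'I_G -> R)
    (i : 'I_G) : R :=
  (G%:R - 1)^-1 * \sum_(j < G | j != i) r j.

(* Main.v *)
Require Import Defs.
From mathcomp Require Import all_boot all_order all_algebra.
From mathcomp Require Import reals.
From mathcomp Require Import ring.

Import GRing.Theory Num.Theory.

Local Open Scope ring_scope.

(** Let [S] be the sum of the rewards other than [r i]. The mean is [(r i + S) / G] and the baseline
    is [S / (G - 1)], so both sides equal [((G - 1) * r i - S) / G]. *)

Theorem proposition1 (R : realType) (G : nat) (hG : (2 <= G)%N)
    (r : 'I_G -> R) (i : 'I_G) :
  r i - group_mean r = (G%:R - 1) / G%:R * (r i - rloo_baseline r i).
Proof.
have G_neq0 : G%:R != 0 :> R by rewrite pnatr_eq0 -lt0n ltnW.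
have G1_neq0 : G%:R - 1 != 0 :> R by rewrite subr_eq0 pnatr_eq1 gtn_eqF.
(* Splitting [r i] off the full sum leaves exactly the baseline's sum, so [field] can treat it as a
   single atom; the denominators [G] and [G - 1] are nonzero by [hG]. *)
rewrite /group_mean /rloo_baseline (bigD1 i) //=.
by field; rewrite G1_neq0 G_neq0.
Qed.
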